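(* Let $A_0,\dots,A_{n-1}$ be subalgebras of a Boolean algebra $B$. If $(A_i)_{i<n}$ weakly commutes well, then it commutes well.
   Context: $\langle S\rangle$ is the subalgebra generated by $S$. Given subalgebras $C_0,\dots,C_{k-1}$ of $B$: they commute if the unique homomorphism to $B$ from the quotient of the free product $\bigoplus_{i<k}C_i$ (cofactor maps $\iota_i$) by the ideal generated by all $\iota_i(z)\wedge\iota_j(-z)$, $z\in C_i\cap C_j$, extending the inclusions, is injective. They weakly commute if for every $\vec x\in\prod_{i<k}C_i$ with $\bigwedge_{i<k}x_i=0$ there exists $\vec y$ with $\bigwedge_{i<k}y_i=0$ and $x_i\le y_i\in\langle C_i\cap\bigcup_{j\ne i}C_j\rangle$ for each $i<k$. The sequence $(A_i)_{i<n}$ (weakly) commutes well if $(A_i)_{i<m}$ (weakly) commutes for every $m\le n$. *)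

(* Defs.v *)
From HB Require Import structures.
From mathcomp Require Import all_boot all_order.
From mathcomp Require Import boolp classical_sets.

Set Implicit Arguments.
Unset Strict Implicit.
Unset Printing Implicit Defensive.

Import Order.Theory.
Local Open Scope quotient_scope.
Local Open Scope order_scope.

(* Boolean algebras are the [ctbDistrLatticeType]s. Their axioms do not exclude
   the one-element algebra; there, [commuting] fails for the empty family, whose
   free product is the two-element algebra, so \bot <> \top has to be assumed
   separately wherever prefixes of length 0 matter. *)

(* [{tblmorphism A -> D}] cannot serve here: as defined in order.v it only
   requires \bot and \top to be preserved. *)
Definition boolean_morphism d (A : ctbDistrLatticeType d)
    d' (D : ctbDistrLatticeType d') (f : A -> D) : Prop :=
  [/\ {morph f : x y / x `&` y}, {morph f : x y / x `|` y},
      {morph f : x / ~` x}, f \bot = \bot & f \top = \top].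

Definition is_subalgebra d (B : ctbDistrLatticeType d) (S : set B) : Prop :=
  [/\ S \bot, S \top, forall x y, S x -> S y -> S (x `&` y),
      forall x y, S x -> S y -> S (x `|` y) & forall x, S x -> S (~` x)].

Record subalgebra d (B : ctbDistrLatticeType d) := Subalgebra {
  subalgebra_carrier :> set B;
  subalgebraP : is_subalgebra subalgebra_carrier }.

Definition generated d (B : ctbDistrLatticeType d) (S : set B) : set B :=
  smallest (@is_subalgebra d B) S.

Lemma is_subalgebra_generated d (B : ctbDistrLatticeType d) (S : set B) :
  is_subalgebra (generated S).
Proof.
split.
- by move=> M [[]].
- by move=> M [[]].
- by move=> x y Sx Sy M MP; case: (MP) => -[_ _ MI _ _] _;
    apply: MI; [apply: Sx | apply: Sy].
- by move=> x y Sx Sy M MP; case: (MP) => -[_ _ _ MU _] _;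
    apply: MU; [apply: Sx | apply: Sy].
- by move=> x Sx M MP; case: (MP) => -[_ _ _ _ MC] _; apply: MC; apply: Sx.
Qed.

Record subalgebra_type d (B : ctbDistrLatticeType d) (C : subalgebra B) :=
  SubalgebraElt {
    subalgebra_val : B;
    subalgebra_valP : subalgebra_val \in subalgebra_carrier C }.

Section SubalgebraType.
Variables (d : Order.disp_t) (B : ctbDistrLatticeType d) (C : subalgebra B).
Notation S := (fun x : B => x \in subalgebra_carrier C).
Notation U := (subalgebra_type C).

HB.instance Definition _ := [isSub for @subalgebra_val d B C].
HB.instance Definition _ := [Choice of U by <:].

Fact subalgebra_meet_closed : {in S &, forall x y : B, x `&` y \in S}.
Proof.
move=> x y /set_mem xC /set_mem yC.
by apply/mem_set; case: (subalgebraP C) => _ _ CI _ _; apply: CI.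
Qed.

Fact subalgebra_join_closed : {in S &, forall x y : B, x `|` y \in S}.
Proof.
move=> x y /set_mem xC /set_mem yC.
by apply/mem_set; case: (subalgebraP C) => _ _ _ CU _; apply: CU.
Qed.

Fact subalgebra_bot : \bot \in S.
Proof. by apply/mem_set; case: (subalgebraP C). Qed.

Fact subalgebra_top : \top \in S.
Proof. by apply/mem_set; case: (subalgebraP C). Qed.

HB.instance Definition _ := Order.SubChoice_isTBSubLattice.Build d B S d U
  subalgebra_meet_closed subalgebra_join_closed subalgebra_bot subalgebra_top.

Fact subalgebra_valI : {morph (val : U -> B) : x y / x `&` y}.
Proof. exact: (@Order.valI_subproof d B S d U). Qed.

Fact subalgebra_valU : {morph (val : U -> B) : x y / x `|` y}.
Proof. exact: (@Order.valU_subproof d B S d U). Qed.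

Fact subalgebra_val0 : val (\bot : U) = \bot.
Proof. exact: (@Order.val0_subproof d B S d U). Qed.

Fact subalgebra_val1 : val (\top : U) = \top.
Proof. exact: (@Order.val1_subproof d B S d U). Qed.

Fact subalgebra_meetUl : left_distributive (@Order.meet d U) (@Order.join d U).
Proof.
move=> x y z; apply: val_inj.
by rewrite subalgebra_valI !subalgebra_valU !subalgebra_valI meetUl.
Qed.

HB.instance Definition _ :=
  Order.Lattice_Meet_isDistrLattice.Build d U subalgebra_meetUl.

Fact subalgebra_compl_closed (x : U) : ~` (val x) \in S.
Proof.
apply/mem_set; case: (subalgebraP C) => _ _ _ _ CC; apply: CC.
exact: set_mem (valP x).
Qed.

Definition subalgebra_compl (x : U) : U := SubalgebraElt (subalgebra_compl_closed x).

Fact subalgebra_joinxC (x : U) : x `|` subalgebra_compl x = \top.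
Proof. by apply: val_inj; rewrite subalgebra_valU subalgebra_val1 joinxC. Qed.

Fact subalgebra_meetxC (x : U) : x `&` subalgebra_compl x = \bot.
Proof. by apply: val_inj; rewrite subalgebra_valI subalgebra_val0 meetxC. Qed.

HB.instance Definition _ := Order.TBDistrLattice_hasComplement.Build d U
  subalgebra_joinxC subalgebra_meetxC.

Lemma val_boolean_morphism : boolean_morphism (val : U -> B).
Proof.
split=> [x y|x y|x||]; first exact: subalgebra_valI.
- exact: subalgebra_valU.
- by [].
- exact: subalgebra_val0.
- exact: subalgebra_val1.
Qed.
End SubalgebraType.

Section FreeProduct.
Variables (d : Order.disp_t) (I : Type) (A : I -> ctbDistrLatticeType d).

Inductive boolean_term : Type :=
| TGen i of A i
| TBot
| TTop
| TMeet of boolean_term & boolean_term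
| TJoin of boolean_term & boolean_term
| TCompl of boolean_term.

HB.instance Definition _ := gen_eqMixin boolean_term.
HB.instance Definition _ := gen_choiceMixin boolean_term.

Fixpoint eval_term d' (D : ctbDistrLatticeType d') (f : forall i, A i -> D)
    (t : boolean_term) : D :=
  match t with
  | TGen i a => f i a
  | TBot => \bot
  | TTop => \top
  | TMeet s t => eval_term f s `&` eval_term f t
  | TJoin s t => eval_term f s `|` eval_term f t
  | TCompl s => ~` (eval_term f s)
  end.

(* The free product is the set of terms over the disjoint union of the factors,
   two terms being identified when they take the same value under every family
   of homomorphisms from the factors to one Boolean algebra. *)
Definition term_eqv (s t : boolean_term) : Prop :=
  forall d' (D : ctbDistrLatticeType d') (f : forall i, A i -> D),
    (forall i, boolean_morphism (f i)) -> eval_term f s = eval_term f t.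

Definition term_eqvb : rel boolean_term := fun s t => `[< term_eqv s t >].

Fact term_eqvb_refl : reflexive term_eqvb.
Proof. by move=> s; apply/asboolP. Qed.

Fact term_eqvb_sym : symmetric term_eqvb.
Proof.
by move=> s t; apply/asboolP/asboolP => st d' D f fP; rewrite (st d' D f fP).
Qed.

Fact term_eqvb_trans : transitive term_eqvb.
Proof.
move=> t s u /asboolP st /asboolP tu; apply/asboolP => d' D f fP.
by rewrite (st d' D f fP) (tu d' D f fP).
Qed.

Canonical term_equiv_rel :=
  EquivRel term_eqvb term_eqvb_refl term_eqvb_sym term_eqvb_trans.

Definition free_product := {eq_quot term_eqvb}.
HB.instance Definition _ := Choice.on free_product.
HB.instance Definition _ := Quotient.on free_product.

Definition fp_pi (t : boolean_term) : free_product := \pi_free_product t.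

Lemma fp_piP (s t : boolean_term) : fp_pi s = fp_pi t <-> term_eqv s t.
Proof. by split=> [/eqmodP /asboolP|st]; [|apply/eqmodP/asboolP]. Qed.

Lemma fp_repr t : term_eqv (repr (fp_pi t)) t.
Proof. by apply/fp_piP; rewrite /fp_pi reprK. Qed.

Lemma fp_piW (P : free_product -> Prop) : (forall t, P (fp_pi t)) -> forall x, P x.
Proof. by move=> Ppi x; rewrite -[x]reprK; apply: Ppi. Qed.

Definition fp_meet (x y : free_product) : free_product :=
  fp_pi (TMeet (repr x) (repr y)).
Definition fp_join (x y : free_product) : free_product :=
  fp_pi (TJoin (repr x) (repr y)).
Definition fp_compl (x : free_product) : free_product := fp_pi (TCompl (repr x)).

Lemma fp_meetE s t : fp_meet (fp_pi s) (fp_pi t) = fp_pi (TMeet s t).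
Proof. by apply/fp_piP => d' D f fP /=; rewrite !(fp_repr _ fP). Qed.
Lemma fp_joinE s t : fp_join (fp_pi s) (fp_pi t) = fp_pi (TJoin s t).
Proof. by apply/fp_piP => d' D f fP /=; rewrite !(fp_repr _ fP). Qed.
Lemma fp_complE s : fp_compl (fp_pi s) = fp_pi (TCompl s).
Proof. by apply/fp_piP => d' D f fP /=; rewrite !(fp_repr _ fP). Qed.

Definition fp_le (x y : free_product) : bool := fp_meet x y == x.
Definition fp_lt (x y : free_product) : bool := (y != x) && fp_le x y.

Fact fp_meetC : commutative fp_meet.
Proof.
elim/fp_piW=> s; elim/fp_piW=> t; rewrite !fp_meetE.
by apply/fp_piP => d' D f _ /=; rewrite meetC.
Qed.
Fact fp_joinC : commutative fp_join.
Proof.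
elim/fp_piW=> s; elim/fp_piW=> t; rewrite !fp_joinE.
by apply/fp_piP => d' D f _ /=; rewrite joinC.
Qed.
Fact fp_meetA : associative fp_meet.
Proof.
elim/fp_piW=> s; elim/fp_piW=> t; elim/fp_piW=> u; rewrite !fp_meetE.
by apply/fp_piP => d' D f _ /=; rewrite meetA.
Qed.
Fact fp_joinA : associative fp_join.
Proof.
elim/fp_piW=> s; elim/fp_piW=> t; elim/fp_piW=> u; rewrite !fp_joinE.
by apply/fp_piP => d' D f _ /=; rewrite joinA.
Qed.
Fact fp_joinKI (y x : free_product) : fp_meet x (fp_join x y) = x.
Proof.
elim/fp_piW: x => s; elim/fp_piW: y => t; rewrite fp_joinE fp_meetE.
by apply/fp_piP => d' D f _ /=; rewrite joinKI.
Qed.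
Fact fp_meetKU (y x : free_product) : fp_join x (fp_meet x y) = x.
Proof.
elim/fp_piW: x => s; elim/fp_piW: y => t; rewrite fp_meetE fp_joinE.
by apply/fp_piP => d' D f _ /=; rewrite meetKU.
Qed.
Fact fp_meetUl : left_distributive fp_meet fp_join.
Proof.
elim/fp_piW=> s; elim/fp_piW=> t; elim/fp_piW=> u.
rewrite !(fp_meetE, fp_joinE).
by apply/fp_piP => d' D f _ /=; rewrite meetUl.
Qed.
Fact fp_meetxx : idempotent_op fp_meet.
Proof.
elim/fp_piW=> s; rewrite fp_meetE.
by apply/fp_piP => d' D f _ /=; rewrite meetxx.
Qed.

HB.instance Definition _ := Order.isMeetJoinDistrLattice.Build d free_product
  (fun _ _ => erefl) (fun _ _ => erefl) fp_meetC fp_joinC fp_meetA fp_joinA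
  fp_joinKI fp_meetKU fp_meetUl fp_meetxx.

Fact fp_le0x (x : free_product) : fp_pi TBot <= x.
Proof.
elim/fp_piW: x => s; apply/eqP; rewrite [LHS]fp_meetE.
by apply/fp_piP => d' D f _ /=; rewrite meet0x.
Qed.
Fact fp_lex1 (x : free_product) : x <= fp_pi TTop.
Proof.
elim/fp_piW: x => s; apply/eqP; rewrite [LHS]fp_meetE.
by apply/fp_piP => d' D f _ /=; rewrite meetx1.
Qed.

HB.instance Definition _ := Order.hasBottom.Build d free_product fp_le0x.
HB.instance Definition _ := Order.hasTop.Build d free_product fp_lex1.

Fact fp_joinxC (x : free_product) : x `|` fp_compl x = \top.
Proof.
elim/fp_piW: x => s; rewrite fp_complE [LHS]fp_joinE.
by apply/fp_piP => d' D f _ /=; rewrite joinxC.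
Qed.
Fact fp_meetxC (x : free_product) : x `&` fp_compl x = \bot.
Proof.
elim/fp_piW: x => s; rewrite fp_complE [LHS]fp_meetE.
by apply/fp_piP => d' D f _ /=; rewrite meetxC.
Qed.

HB.instance Definition _ := Order.TBDistrLattice_hasComplement.Build d free_product
  fp_joinxC fp_meetxC.

Definition cofactor i (a : A i) : free_product := fp_pi (TGen a).

Lemma cofactor_boolean_morphism i : boolean_morphism (@cofactor i).
Proof.
split=> [x y|x y|x||]; apply: esym.
- rewrite [LHS]fp_meetE; apply/fp_piP => d' D f fP /=.
  by case: (fP i) => fI _ _ _ _; rewrite fI.
- rewrite [LHS]fp_joinE; apply/fp_piP => d' D f fP /=.
  by case: (fP i) => _ fU _ _ _; rewrite fU.
- rewrite [LHS]fp_complE; apply/fp_piP => d' D f fP /=.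
  by case: (fP i) => _ _ fC _ _; rewrite fC.
- by apply/fp_piP => d' D f fP /=; case: (fP i) => _ _ _ f0 _; rewrite f0.
- by apply/fp_piP => d' D f fP /=; case: (fP i) => _ _ _ _ f1; rewrite f1.
Qed.

Section Lift.
Variables (d' : Order.disp_t) (D : ctbDistrLatticeType d').
Variable f : forall i, A i -> D.
Arguments f : clear implicits.

Definition free_lift (x : free_product) : D := eval_term f (repr x).

Hypothesis fP : forall i, boolean_morphism (f i).

Lemma free_liftE t : free_lift (fp_pi t) = eval_term f t.
Proof. exact: fp_repr. Qed.

Lemma free_lift_cofactor i (a : A i) : free_lift (cofactor a) = f i a.
Proof. exact: free_liftE. Qed.

Lemma free_lift_boolean_morphism : boolean_morphism free_lift.
Proof.
split=> [||||]; try exact: free_liftE.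
- elim/fp_piW=> s; elim/fp_piW=> t.
  by rewrite [X in free_lift X]fp_meetE !free_liftE.
- elim/fp_piW=> s; elim/fp_piW=> t.
  by rewrite [X in free_lift X]fp_joinE !free_liftE.
- by elim/fp_piW=> s; rewrite [X in free_lift X]fp_complE !free_liftE.
Qed.

Lemma free_lift_unique (h : free_product -> D) :
  boolean_morphism h -> (forall i (a : A i), h (cofactor a) = f i a) ->
  h =1 free_lift.
Proof.
case=> hI hU hC h0 h1 hf; elim/fp_piW=> t; rewrite free_liftE.
elim: t => [i a|||s IHs t IHt|s IHs t IHt|s IHs] //=.
- exact: hf.
- by rewrite -fp_meetE hI IHs IHt.
- by rewrite -fp_joinE hU IHs IHt.
- by rewrite -fp_complE hC IHs.
Qed.
End Lift.
End FreeProduct.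

Definition is_ideal d (B : ctbDistrLatticeType d) (J : set B) : Prop :=
  [/\ J \bot, forall x y, J x -> J y -> J (x `|` y)
    & forall x y, x <= y -> J y -> J x].

Record ideal d (B : ctbDistrLatticeType d) := Ideal {
  ideal_carrier :> set B;
  idealP : is_ideal ideal_carrier }.

Lemma is_ideal_generated d (B : ctbDistrLatticeType d) (S : set B) :
  is_ideal (smallest (@is_ideal d B) S).
Proof.
split.
- by move=> M [[]].
- by move=> x y Sx Sy M MP; case: (MP) => -[_ MU _] _;
    apply: MU; [apply: Sx | apply: Sy].
- by move=> x y xy Sy M MP; case: (MP) => -[_ _ Mle] _;
    apply: Mle xy _; apply: Sy.
Qed.

Definition ideal_generated d (B : ctbDistrLatticeType d) (S : set B) : ideal B :=
  Ideal (is_ideal_generated S).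

Section IdealQuotient.
Variables (d : Order.disp_t) (B : ctbDistrLatticeType d) (K : ideal B).
Notation J := (ideal_carrier K).
Implicit Types x y z : B.

Definition ideal_eqv x y : Prop := J ((x `\` y) `|` (y `\` x)).

Definition ideal_eqvb : rel B := fun x y => `[< ideal_eqv x y >].

Lemma ideal0 : J \bot. Proof. by case: (idealP K). Qed.
Lemma idealU x y : J x -> J y -> J (x `|` y).
Proof. by case: (idealP K) => _ JU _; apply: JU. Qed.
Lemma ideal_le x y : x <= y -> J y -> J x.
Proof. by case: (idealP K) => _ _ Jle; apply: Jle. Qed.

Lemma ideal_eqvP x y :
  ideal_eqv x y <-> exists2 j, J j & x `|` j = y `|` j.
Proof.
split=> [Jxy|[j Jj xyj]].
  exists ((x `\` y) `|` (y `\` x)) => //.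
  have xE : x `|` (y `\` x) = x `|` y.
    by rewrite diffE joinIr joinxC meetx1.
  have yE : y `|` (x `\` y) = x `|` y.
    by rewrite diffE joinIr joinxC meetx1 joinC.
  have xyL : x `\` y `|` (x `|` y) = x `|` y.
    by apply: join_r; rewrite (le_trans (leBx _ _)) ?leUl.
  have xyR : x `|` y `|` (y `\` x) = x `|` y.
    by apply: join_l; rewrite (le_trans (leBx _ _)) ?leUr.
  by rewrite joinCA xE xyL joinA yE xyR.
apply: ideal_le Jj; rewrite leUx !leBLR.
by rewrite -xyj leUl /= xyj leUl.
Qed.

Fact ideal_eqvb_refl : reflexive ideal_eqvb.
Proof. by move=> x; apply/asboolP/ideal_eqvP; exists \bot => //; exact: ideal0. Qed.

Fact ideal_eqvb_sym : symmetric ideal_eqvb.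
Proof. by move=> x y; rewrite /ideal_eqvb /ideal_eqv joinC. Qed.

Fact ideal_eqvb_trans : transitive ideal_eqvb.
Proof.
move=> y x z /asboolP/ideal_eqvP [j Jj xy] /asboolP/ideal_eqvP [k Jk yz].
apply/asboolP/ideal_eqvP; exists (j `|` k); first exact: idealU.
by rewrite joinA xy joinAC yz joinAC joinA.
Qed.

Canonical ideal_equiv_rel :=
  EquivRel ideal_eqvb ideal_eqvb_refl ideal_eqvb_sym ideal_eqvb_trans.

Definition ideal_quotient := {eq_quot ideal_eqvb}.
HB.instance Definition _ := Choice.on ideal_quotient.
HB.instance Definition _ := Quotient.on ideal_quotient.

Definition quot_pi (x : B) : ideal_quotient := \pi_ideal_quotient x.

Lemma quot_piP x y : quot_pi x = quot_pi y <-> ideal_eqv x y.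
Proof. by split=> [/eqmodP /asboolP|st]; [|apply/eqmodP/asboolP]. Qed.

Lemma quot_repr x : ideal_eqv (repr (quot_pi x)) x.
Proof. by apply/quot_piP; rewrite /quot_pi reprK. Qed.

Lemma quot_piW (P : ideal_quotient -> Prop) :
  (forall x, P (quot_pi x)) -> forall u, P u.
Proof. by move=> Ppi u; rewrite -[u]reprK; apply: Ppi. Qed.

Definition quot_meet (u v : ideal_quotient) : ideal_quotient :=
  quot_pi (repr u `&` repr v).
Definition quot_join (u v : ideal_quotient) : ideal_quotient :=
  quot_pi (repr u `|` repr v).
Definition quot_compl (u : ideal_quotient) : ideal_quotient :=
  quot_pi (~` (repr u)).

Lemma quot_meetE x y : quot_meet (quot_pi x) (quot_pi y) = quot_pi (x `&` y).
Proof.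
have /ideal_eqvP [j Jj xj] := quot_repr x.
have /ideal_eqvP [k Jk yk] := quot_repr y.
apply/quot_piP/ideal_eqvP; exists (j `|` k); first exact: idealU.
have yjk : repr (quot_pi y) `|` (j `|` k) = y `|` (j `|` k).
  by rewrite joinCA yk joinCA.
by rewrite !joinIl yjk !joinA xj.
Qed.
Lemma quot_joinE x y : quot_join (quot_pi x) (quot_pi y) = quot_pi (x `|` y).
Proof.
have /ideal_eqvP [j Jj xj] := quot_repr x.
have /ideal_eqvP [k Jk yk] := quot_repr y.
apply/quot_piP/ideal_eqvP; exists (j `|` k); first exact: idealU.
by rewrite joinACA xj yk joinACA.
Qed.
Lemma quot_complE x : quot_compl (quot_pi x) = quot_pi (~` x).
Proof.
have /ideal_eqvP [j Jj xj] := quot_repr x.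
apply/quot_piP/ideal_eqvP; exists j => //.
rewrite -[j]complK -!complI; congr (~` _).
rewrite -[LHS]joinx0 -(meetxC j) -[RHS]joinx0 -(meetxC j).
rewrite ![_ `|` (j `&` _)]joinC.
by rewrite -!meetUl ![j `|` _]joinC xj.
Qed.

Definition quot_le (u v : ideal_quotient) : bool := quot_meet u v == u.
Definition quot_lt (u v : ideal_quotient) : bool := (v != u) && quot_le u v.

Fact quot_meetC : commutative quot_meet.
Proof. by elim/quot_piW=> x; elim/quot_piW=> y; rewrite !quot_meetE meetC. Qed.
Fact quot_joinC : commutative quot_join.
Proof. by elim/quot_piW=> x; elim/quot_piW=> y; rewrite !quot_joinE joinC. Qed.
Fact quot_meetA : associative quot_meet.
Proof.
by elim/quot_piW=> x; elim/quot_piW=> y; elim/quot_piW=> z; rewrite !quot_meetE meetA.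
Qed.
Fact quot_joinA : associative quot_join.
Proof.
by elim/quot_piW=> x; elim/quot_piW=> y; elim/quot_piW=> z; rewrite !quot_joinE joinA.
Qed.
Fact quot_joinKI (v u : ideal_quotient) : quot_meet u (quot_join u v) = u.
Proof.
by elim/quot_piW: u => x; elim/quot_piW: v => y; rewrite quot_joinE quot_meetE joinKI.
Qed.
Fact quot_meetKU (v u : ideal_quotient) : quot_join u (quot_meet u v) = u.
Proof.
by elim/quot_piW: u => x; elim/quot_piW: v => y; rewrite quot_meetE quot_joinE meetKU.
Qed.
Fact quot_meetUl : left_distributive quot_meet quot_join.
Proof.
elim/quot_piW=> x; elim/quot_piW=> y; elim/quot_piW=> z.
by rewrite !(quot_meetE, quot_joinE) meetUl.
Qed.
Fact quot_meetxx : idempotent_op quot_meet.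
Proof. by elim/quot_piW=> x; rewrite quot_meetE meetxx. Qed.

HB.instance Definition _ := Order.isMeetJoinDistrLattice.Build d ideal_quotient
  (fun _ _ => erefl) (fun _ _ => erefl) quot_meetC quot_joinC quot_meetA quot_joinA
  quot_joinKI quot_meetKU quot_meetUl quot_meetxx.

Fact quot_le0x (u : ideal_quotient) : quot_pi \bot <= u.
Proof. by elim/quot_piW: u => x; apply/eqP; rewrite [LHS]quot_meetE meet0x. Qed.
Fact quot_lex1 (u : ideal_quotient) : u <= quot_pi \top.
Proof. by elim/quot_piW: u => x; apply/eqP; rewrite [LHS]quot_meetE meetx1. Qed.

HB.instance Definition _ := Order.hasBottom.Build d ideal_quotient quot_le0x.
HB.instance Definition _ := Order.hasTop.Build d ideal_quotient quot_lex1.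

Fact quot_joinxC (u : ideal_quotient) : u `|` quot_compl u = \top.
Proof. by elim/quot_piW: u => x; rewrite quot_complE [LHS]quot_joinE joinxC. Qed.
Fact quot_meetxC (u : ideal_quotient) : u `&` quot_compl u = \bot.
Proof. by elim/quot_piW: u => x; rewrite quot_complE [LHS]quot_meetE meetxC. Qed.

HB.instance Definition _ :=
  Order.TBDistrLattice_hasComplement.Build d ideal_quotient quot_joinxC quot_meetxC.

Lemma quot_pi_boolean_morphism : boolean_morphism quot_pi.
Proof.
split=> [x y|x y|x||] //; apply: esym.
- exact: quot_meetE.
- exact: quot_joinE.
- exact: quot_complE.
Qed.

Section Lift.
Variables (d' : Order.disp_t) (D : ctbDistrLatticeType d') (h : B -> D).

Definition quot_lift (u : ideal_quotient) : D := h (repr u).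

Hypotheses (hP : boolean_morphism h) (hJ : forall x, J x -> h x = \bot).

Lemma quot_liftE x : quot_lift (quot_pi x) = h x.
Proof.
have /ideal_eqvP [j Jj xj] := quot_repr x; case: hP => _ hU _ _ _.
by rewrite /quot_lift -[LHS]joinx0 -(hJ Jj) -hU xj hU (hJ Jj) joinx0.
Qed.

Lemma quot_lift_boolean_morphism : boolean_morphism quot_lift.
Proof.
case: (hP) => hI hU hC h0 h1; split=> [||||].
- elim/quot_piW=> x; elim/quot_piW=> y.
  by rewrite [X in quot_lift X]quot_meetE !quot_liftE hI.
- elim/quot_piW=> x; elim/quot_piW=> y.
  by rewrite [X in quot_lift X]quot_joinE !quot_liftE hU.
- by elim/quot_piW=> x; rewrite [X in quot_lift X]quot_complE !quot_liftE hC.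
- by rewrite [LHS]quot_liftE.
- by rewrite [LHS]quot_liftE.
Qed.
End Lift.
End IdealQuotient.

Section Commuting.
Variables (d : Order.disp_t) (B : ctbDistrLatticeType d).
Variables (k : nat) (C : 'I_k -> subalgebra B).

Definition sub_free_product := free_product (fun i => subalgebra_type (C i)).

Definition sub_cofactor (i : 'I_k) : subalgebra_type (C i) -> sub_free_product :=
  @cofactor d 'I_k (fun i => subalgebra_type (C i)) i.

(* An element of C_i `&` C_j is given by [z] in C_i and [z'] in C_j with the
   same value in [B]. *)
Definition gluing : set sub_free_product :=
  [set w | exists (i j : 'I_k) (z : subalgebra_type (C i))
             (z' : subalgebra_type (C j)),
     val z = val z' /\ w = sub_cofactor z `&` sub_cofactor (~` z')].

Definition amalgam := ideal_quotient (ideal_generated gluing).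

Definition amalgam_in (i : 'I_k) (a : subalgebra_type (C i)) : amalgam :=
  quot_pi (ideal_generated gluing) (sub_cofactor a).

Definition amalgam_map : amalgam -> B :=
  quot_lift (free_lift (fun i (a : subalgebra_type (C i)) => val a)).

Let fval_morphism :
  boolean_morphism (free_lift (fun i (a : subalgebra_type (C i)) => val a)).
Proof.
by apply: free_lift_boolean_morphism => i; exact: val_boolean_morphism.
Qed.

Let fval_gluing x : ideal_carrier (ideal_generated gluing) x ->
  free_lift (fun i (a : subalgebra_type (C i)) => val a) x = \bot.
Proof.
case: (fval_morphism) => hI hU hC h0 h1.
apply: (smallest_sub (X := [set x | free_lift _ x = \bot])) => /= [|w].
  split=> //= [y z hy hz|y z yz hz]; first by rewrite hU hy hz joinxx.
  by apply/eqP; rewrite -lex0 -hz leEmeet -hI meet_l.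
move=> [i [j [z [z' [zz' ->]]]]] /=.
rewrite hI !free_lift_cofactor; try by move=> l; exact: val_boolean_morphism.
by case: (val_boolean_morphism (C j)) => _ _ -> _ _; rewrite zz' meetxC.
Qed.

Lemma amalgam_map_boolean_morphism : boolean_morphism amalgam_map.
Proof. exact: quot_lift_boolean_morphism. Qed.

Lemma amalgam_map_in (i : 'I_k) (a : subalgebra_type (C i)) :
  amalgam_map (amalgam_in a) = val a.
Proof.
rewrite /amalgam_map quot_liftE //.
by apply: free_lift_cofactor => l; exact: val_boolean_morphism.
Qed.

Lemma amalgam_map_unique (h : amalgam -> B) :
  boolean_morphism h ->
  (forall (i : 'I_k) (a : subalgebra_type (C i)), h (amalgam_in a) = val a) ->
  h =1 amalgam_map.
Proof.
case=> hI hU hC h0 h1 hv; elim/quot_piW=> x; rewrite /amalgam_map quot_liftE //.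
case: (quot_pi_boolean_morphism (ideal_generated gluing)) => pI pU pC p0 p1.
pose g y := h (quot_pi (ideal_generated gluing) y).
apply: (@free_lift_unique _ _ _ _ _ _ _ g) => //.
by split=> [y z|y z|y||]; rewrite /g ?pI ?pU ?pC ?p0 ?p1.
Qed.

Definition commuting : Prop := injective amalgam_map.

Definition weakly_commuting : Prop :=
  forall x : 'I_k -> B, (forall i, subalgebra_carrier (C i) (x i)) ->
  \meet_(i < k) x i = \bot ->
  exists y : 'I_k -> B, \meet_(i < k) y i = \bot /\
    forall i, x i <= y i /\
      generated (C i `&` \bigcup_(j in [set~ i]) C j)%classic (y i).
End Commuting.

Definition prefix_family d (B : ctbDistrLatticeType d) n
    (A : 'I_n -> subalgebra B) m (le_mn : (m <= n)%N) : 'I_m -> subalgebra B :=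
  fun i => A (widen_ord le_mn i).

Definition commutes_well d (B : ctbDistrLatticeType d) n
    (A : 'I_n -> subalgebra B) : Prop :=
  forall m (le_mn : (m <= n)%N), commuting (prefix_family A le_mn).

Definition weakly_commutes_well d (B : ctbDistrLatticeType d) n
    (A : 'I_n -> subalgebra B) : Prop :=
  forall m (le_mn : (m <= n)%N), weakly_commuting (prefix_family A le_mn).

(* Main.v *)
(** An element of the amalgam of [C] is null as soon as this holds for the
   elements [\meet_i c_i] with [c_i] the image of some [x_i] in [C i], because
   every element is a finite join of such meets.  If [\meet_i x_i = \bot] in [B],
   weak commutativity replaces the last coordinate [x_k] by some [y_k >= x_k]
   generated by elements which [C k] shares with the earlier algebras.  In the
   amalgam, [y_k] is thus a Boolean combination of images of the earlier
   algebras, and the meet is null by induction on the length of the family. *)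
Require Import Defs.
From HB Require Import structures.
From mathcomp Require Import all_boot all_order.
From mathcomp Require Import boolp classical_sets.

Set Implicit Arguments.
Unset Strict Implicit.
Unset Printing Implicit Defensive.

Import Order.Theory.
Local Open Scope order_scope.

(** A single function on all of [B], constrained only on [S], encodes a compatible family of
    homomorphisms: elements shared by two subalgebras have one image. *)
Definition morphism_on d (B : ctbDistrLatticeType d) d'
    (D : ctbDistrLatticeType d') (S : set B) (g : B -> D) : Prop :=
  [/\ forall x y, S x -> S y -> g (x `&` y) = g x `&` g y,
      forall x y, S x -> S y -> g (x `|` y) = g x `|` g y,
      forall x, S x -> g (~` x) = ~` (g x), g \bot = \bot & g \top = \top].

Lemma morphism_on_le d (B : ctbDistrLatticeType d) d'
    (D : ctbDistrLatticeType d') (S : set B) (g : B -> D) x y :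
  morphism_on S g -> S x -> S y -> x <= y -> g x <= g y.
Proof. by case=> gI _ _ _ _ Sx Sy xy; rewrite leEmeet -gI // meet_l. Qed.

Section GraphClosure.
Variables (d : Order.disp_t) (B : ctbDistrLatticeType d).
Variables (d' : Order.disp_t) (D : ctbDistrLatticeType d').
Variables (k : nat) (C : 'I_k -> subalgebra B) (g : B -> D).

(* The subalgebra of [B * D] generated by the graph of [g] on the union of the
   [C i]: closure under complement holds because each [C i] is so closed. *)
Inductive graph_closure : B -> D -> Prop :=
| graph_gen i b of subalgebra_carrier (C i) b : graph_closure b (g b)
| graph_bot : graph_closure \bot \bot
| graph_top : graph_closure \top \top
| graph_meet b e b' e' of graph_closure b e & graph_closure b' e' :
    graph_closure (b `&` b') (e `&` e')
| graph_join b e b' e' of graph_closure b e & graph_closure b' e' :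
    graph_closure (b `|` b') (e `|` e').

(** Disjunctive normal forms, built in [B] and [D] in parallel from the same coordinates. *)
Inductive joins_of_meets : B -> D -> Prop :=
| joins_bot : joins_of_meets \bot \bot
| joins_cons (x : 'I_k -> B) b e of
    (forall i, subalgebra_carrier (C i) (x i)) & joins_of_meets b e :
    joins_of_meets (\meet_i x i `|` b) (\meet_i g (x i) `|` e).

Hypothesis gP : forall i, morphism_on (C i) g.

Lemma graph_compl b e : graph_closure b e -> graph_closure (~` b) (~` e).
Proof.
elim=> {b e} [i b Cb|||b e b' e' _ IH _ IH'|b e b' e' _ IH _ IH'].
- have [_ _ gC _ _] := gP i; rewrite -gC //; apply: (@graph_gen i).
  by case: (subalgebraP (C i)) => _ _ _ _; apply.
- by rewrite !compl0; exact: graph_top.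
- by rewrite !compl1; exact: graph_bot.
- by rewrite !complI; exact: graph_join.
- by rewrite !complU; exact: graph_meet.
Qed.

Lemma joins_single (x : 'I_k -> B) : (forall i, subalgebra_carrier (C i) (x i)) ->
  joins_of_meets (\meet_i x i) (\meet_i g (x i)).
Proof.
move=> Cx; rewrite -[\meet_i x i]joinx0 -[\meet_i g (x i)]joinx0.
by apply: joins_cons => //; exact: joins_bot.
Qed.

Lemma joins_join b e b' e' : joins_of_meets b e -> joins_of_meets b' e' ->
  joins_of_meets (b `|` b') (e `|` e').
Proof.
move=> + be'; elim=> {b e} [|x b e Cx _ IH]; first by rewrite !join0x.
by rewrite -!joinA; exact: joins_cons.
Qed.

(** By distributivity only two single meets matter; these combine coordinatewise, inside each
    [C i]. *)
Lemma joins_meet b e b' e' : joins_of_meets b e -> joins_of_meets b' e' ->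
  joins_of_meets (b `&` b') (e `&` e').
Proof.
move=> + be'; elim=> {b e} [|x b e Cx _ IH].
  by rewrite !meet0x; exact: joins_bot.
rewrite !meetUl; apply: joins_join => //.
elim: be' => {b e b' e' IH} [|y b e Cy _ IH].
  by rewrite !meetx0; exact: joins_bot.
rewrite !meetUr; apply: joins_join => //.
rewrite -!big_split /=.
under [X in joins_of_meets _ X]eq_bigr => i _.
  have [gI _ _ _ _] := gP i; rewrite -gI //; over.
apply: joins_single => i.
by case: (subalgebraP (C i)) => _ _ CI _ _; exact: CI.
Qed.

Lemma graph_joins b e : graph_closure b e -> joins_of_meets b e.
Proof.
have Ctop i : subalgebra_carrier (C i) \top by case: (subalgebraP (C i)).
have gtop (i : 'I_k) : g \top = \top by case: (gP i).
elim=> {b e} [i b Cb|||b e b' e' _ IH _ IH'|b e b' e' _ IH _ IH'].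
(* A generator from [C i] is the meet of the family padded with [\top] off [i]. *)
- pose x j := if j == i then b else \top.
  have xE : \meet_j x j = b.
    rewrite (bigD1 i) //= /x eqxx big1 ?meetx1 // => j /negbTE ->.
    by [].
  have gxE : \meet_j g (x j) = g b.
    rewrite (bigD1 i) //= /x eqxx big1 ?meetx1 // => j /negbTE ->.
    exact: gtop i.
  rewrite -gxE -{1}xE; apply: joins_single => j.
  by rewrite /x; case: eqP => [->|_].
- exact: joins_bot.
- have := joins_single Ctop.
  by rewrite [in X in joins_of_meets X]big1 // big1 // => i _; exact: gtop i.
- exact: joins_meet.
- exact: joins_join.
Qed.

Lemma graph_null :
  (forall x : 'I_k -> B, (forall i, subalgebra_carrier (C i) (x i)) ->
     \meet_i x i = \bot -> \meet_i g (x i) = \bot) ->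
  forall b e, graph_closure b e -> b = \bot -> e = \bot.
Proof.
move=> meet_null b e /graph_joins; elim=> {b e} // x b e Cx _ IH /eqP.
by rewrite join_eq0 => /andP[/eqP x0 /eqP b0]; rewrite meet_null // IH // joinxx.
Qed.

End GraphClosure.

(** The induction invariant. It ranges over all targets so that, for a shorter family, it still
    applies to the [D] and [g] of the longer one. *)
Definition null_preserving d (B : ctbDistrLatticeType d) k
    (C : 'I_k -> subalgebra B) : Prop :=
  forall d' (D : ctbDistrLatticeType d') (g : B -> D),
    (forall i, morphism_on (C i) g) ->
    forall b e, graph_closure C g b e -> b = \bot -> e = \bot.

(** The empty meet is [\top], which is not null in a nontrivial [B]. *)
Lemma null_preserving0 d (B : ctbDistrLatticeType d) (C : 'I_0 -> subalgebra B) :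
  (\bot : B) <> \top -> null_preserving C.
Proof.
move=> B01 d' D g gP; apply: graph_null => // x _.
by rewrite big_ord0 => /esym.
Qed.

Lemma null_preservingS d (B : ctbDistrLatticeType d) k
    (C : 'I_k.+1 -> subalgebra B) :
  weakly_commuting C ->
  null_preserving (fun i => C (widen_ord (leqnSn k) i)) -> null_preserving C.
Proof.
move=> wC IH d' D g gP; apply: graph_null => // x Cx x0.
have [y [y0 /all_and2[xy genY]]] := wC x Cx x0.
pose C' i := C (widen_ord (leqnSn k) i).
have gP' i : morphism_on (C' i) g by exact: gP.
have [Cy Gy] : subalgebra_carrier (C ord_max) (y ord_max) /\
    graph_closure C' g (y ord_max) (g (y ord_max)).
  have [gI gU gC g0 g1] := gP ord_max.
  have [C0 C1 CI CU CC] := subalgebraP (C ord_max).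
  (* This set is a subalgebra containing what the last algebra shares with the earlier ones, so
     minimality of [generated] puts [y ord_max] in it. *)
  apply: (genY ord_max [set b | subalgebra_carrier (C ord_max) b /\
                                graph_closure C' g b (g b)]%classic).
  split=> [|b [Cb [j jmax Cjb]]].
    split=> /= [||b c [Cb Gb] [Cc Gc]|b c [Cb Gb] [Cc Gc]|b [Cb Gb]].
    - by rewrite g0; split=> //; exact: graph_bot.
    - by rewrite g1; split=> //; exact: graph_top.
    - by rewrite gI //; split; [exact: CI | exact: graph_meet].
    - by rewrite gU //; split; [exact: CU | exact: graph_join].
    - by rewrite gC //; split; [exact: CC | exact: graph_compl].
  split=> //; have ltjk : (j < k)%N.
    rewrite ltn_neqAle -ltnS ltn_ord andbT; apply/eqP => jk.
    by apply: jmax; exact: val_inj.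
  apply: (@graph_gen _ _ _ _ _ _ _ (Ordinal ltjk)); rewrite /C'.
  by have -> : widen_ord (leqnSn k) (Ordinal ltjk) = j by exact: val_inj.
have Gx : graph_closure C' g (\meet_(i < k) x (widen_ord (leqnSn k) i))
    (\meet_(i < k) g (x (widen_ord (leqnSn k) i))).
  apply: (big_ind2 (graph_closure C' g)) => [|b e b' e'|i _].
  - exact: graph_top.
  - exact: graph_meet.
  - by apply: (@graph_gen _ _ _ _ _ _ _ i); exact: Cx.
(* Raising only the last coordinate from [x] to [y] gives a pair in the closure of [C']. Its
   [B]-part lies below the null meet of [y], so [IH] kills its [D]-part, which bounds the goal. *)
apply/eqP; rewrite -lex0 big_ord_recr /=.
rewrite -(IH _ _ _ gP' _ _ (graph_meet Gx Gy)).
  by apply: leI2 => //; exact: morphism_on_le (gP ord_max) _ _ _.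
apply/eqP; rewrite -lex0 -y0 big_ord_recr /=; apply: leI2 => //.
by elim/big_ind2: _ => // *; exact: leI2.
Qed.

Section AmalgamFunction.
Variables (d : Order.disp_t) (B : ctbDistrLatticeType d).
Variables (k : nat) (C : 'I_k -> subalgebra B).

Lemma amalgam_in_boolean_morphism i : boolean_morphism (@amalgam_in d B k C i).
Proof.
have [pI pU pC p0 p1] := quot_pi_boolean_morphism (ideal_generated (@gluing d B k C)).
have [cI cU cC c0 c1] :=
  @cofactor_boolean_morphism d 'I_k (fun i => subalgebra_type (C i)) i.
by split=> [x y|x y|x||]; rewrite /amalgam_in /sub_cofactor
  ?cI ?cU ?cC ?c0 ?c1 ?pI ?pU ?pC ?p0 ?p1.
Qed.

(** The difference of the two images is the class of an element of [gluing]. *)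
Lemma amalgam_in_le i j (a : subalgebra_type (C i)) (b : subalgebra_type (C j)) :
  val a = val b -> amalgam_in a <= amalgam_in b.
Proof.
move=> ab; have [pI _ _ p0 _] :=
  quot_pi_boolean_morphism (ideal_generated (@gluing d B k C)).
have [_ _ iC _ _] := amalgam_in_boolean_morphism j.
suff ab0 : amalgam_in a `&` ~` (amalgam_in b) = \bot.
  by rewrite -diff_eq0 diffE ab0.
rewrite -iC /amalgam_in -pI -p0; apply/quot_piP/ideal_eqvP.
exists (sub_cofactor a `&` sub_cofactor (~` b)); last by rewrite joinxx join0x.
by move=> J [_]; apply; exists i, j, a, b.
Qed.

Lemma amalgam_in_eq i j (a : subalgebra_type (C i)) (b : subalgebra_type (C j)) :
  val a = val b -> amalgam_in a = amalgam_in b.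
Proof. by move=> ab; apply/le_anti; rewrite !amalgam_in_le. Qed.

(* By [amalgam_in_eq], the embeddings of the [C i] glue to one function on their
   union; its value elsewhere is irrelevant. *)
Definition amalgam_fun (b : B) : amalgam C :=
  xget \bot [set e | exists i (a : subalgebra_type (C i)),
                       val a = b /\ e = amalgam_in a]%classic.

Lemma amalgam_funE i (a : subalgebra_type (C i)) :
  amalgam_fun (val a) = amalgam_in a.
Proof.
apply: xget_unique => [|e [j [b [ba ->]]]]; first by exists i, a.
exact: amalgam_in_eq.
Qed.

Lemma amalgam_fun_morphism_on i : morphism_on (C i) amalgam_fun.
Proof.
have [iI iU iC i0 i1] := amalgam_in_boolean_morphism i.
have [vI vU vC v0 v1] := val_boolean_morphism (C i).
pose elt x (Cx : subalgebra_carrier (C i) x) := SubalgebraElt (mem_set Cx).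
have eltE x (Cx : subalgebra_carrier (C i) x) : x = val (elt x Cx) by [].
split=> [x y Cx Cy|x y Cx Cy|x Cx||].
- by rewrite (eltE x Cx) (eltE y Cy) -vI !amalgam_funE iI.
- by rewrite (eltE x Cx) (eltE y Cy) -vU !amalgam_funE iU.
- by rewrite (eltE x Cx) -vC !amalgam_funE iC.
- by rewrite -v0 amalgam_funE i0.
- by rewrite -v1 amalgam_funE i1.
Qed.

(** Induction on a Boolean term representing [u]. *)
Lemma graph_amalgam_map (u : amalgam C) :
  graph_closure C amalgam_fun (amalgam_map u) u.
Proof.
have [mI mU mC m0 m1] := amalgam_map_boolean_morphism C.
have [pI pU pC p0 p1] := quot_pi_boolean_morphism (ideal_generated (@gluing d B k C)).
elim/quot_piW: u; elim/fp_piW.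
elim=> [i a|||s IHs t IHt|s IHs t IHt|s IHs].
- rewrite -/(amalgam_in a) amalgam_map_in -amalgam_funE.
  by apply: (@graph_gen _ _ _ _ _ _ _ i); exact: set_mem (valP a).
- by rewrite p0 m0; exact: graph_bot.
- by rewrite p1 m1; exact: graph_top.
- by rewrite -fp_meetE pI mI; exact: graph_meet.
- by rewrite -fp_joinE pU mU; exact: graph_join.
- by rewrite -fp_complE pC mC; apply: graph_compl IHs; exact: amalgam_fun_morphism_on.
Qed.

Lemma null_preserving_commuting : null_preserving C -> commuting C.
Proof.
have [mI mU mC m0 m1] := amalgam_map_boolean_morphism C.
move=> Cnull; suff le_map (u v : amalgam C) :
    amalgam_map u = amalgam_map v -> u <= v.
  by move=> u v uv; apply/le_anti; rewrite !le_map.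
(* The difference of [u] and [v] is sent to [\bot], so a trivial kernel suffices. *)
move=> uv; rewrite -diff_eq0; apply/eqP.
apply: Cnull (graph_amalgam_map _) _; first exact: amalgam_fun_morphism_on.
by rewrite diffE mI mC uv meetxC.
Qed.

End AmalgamFunction.

Theorem theorem3p50 (d : Order.disp_t) (B : ctbDistrLatticeType d)
    (nontrivial_B : (\bot : B)%O <> (\top : B)%O)
    (n : nat) (A : 'I_n -> subalgebra B) :
  weakly_commutes_well A -> commutes_well A.
Proof.
move=> wA m le_mn; apply: null_preserving_commuting.
(* Each step of the induction uses weak commutativity of the prefix reached, hence the hypothesis on
   all prefixes. *)
elim: m le_mn => [|m IH] lt_mn; first exact: null_preserving0.
apply: null_preservingS (wA _ lt_mn) _.
have -> : (fun i => prefix_family A lt_mn (widen_ord (leqnSn m) i)) =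
    prefix_family A (ltnW lt_mn).
  by apply/funext => i; congr (A _); exact: val_inj.
exact: IH.
Qed.
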